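(* As $n\to\infty$: $\mathrm{sat}_\circlearrowright(n,F)=\Theta(n)$ for $F\in\{M_2,S_1,S_2\}$; $\mathrm{sat}_\circlearrowright(n,F)=\Theta(n^2)$ for $F\in\{M_1,M_3,D_1,D_2\}$; and $\mathrm{sat}_\circlearrowright(n,S_3)=\Omega(n)$ and $\mathrm{sat}_\circlearrowright(n,S_3)=O(n\log_2 n)$.
   Context: A convex geometric hypergraph (cgh) on $\Omega_n=\{v_0,\dots,v_{n-1}\}$ is a family of subsets (edges) of $\Omega_n$, where the vertices carry the cyclic order $v_0<v_1<\dots<v_{n-1}<v_0$ (indices mod $n$). It is a $3$-cgh if all edges have size $3$. For a cgh $F$, $H$ contains a copy of $F$ if there is an injection of the vertex set of $F$ into $\Omega_n$ preserving the cyclic order and mapping every edge of $F$ to an edge of $H$; $H$ is $F$-free if it contains no copy of $F$. $H\subseteq\binom{\Omega_n}{3}$ is $F$-saturated if it is $F$-free and for every $e\in\binom{\Omega_n}{3}\setminus H$, $H\cup\{e\}$ contains a copy of $F$. $\mathrm{sat}_\circlearrowright(n,F)$ is the minimum number of edges of an $F$-saturated $3$-cgh on $\Omega_n$. The following two-edge $3$-cghs are considered (each on the vertex set $\Omega_k$ with $k$ the number of vertices used): $M_1$: $\{v_0,v_1,v_2\},\{v_3,v_4,v_5\}$; $M_2$: $\{v_0,v_1,v_3\},\{v_2,v_4,v_5\}$; $M_3$: $\{v_0,v_2,v_4\},\{v_1,v_3,v_5\}$; $S_1$: $\{v_0,v_1,v_2\},\{v_0,v_3,v_4\}$; $S_2$: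 $\{v_0,v_1,v_4\},\{v_0,v_2,v_3\}$; $S_3$: $\{v_0,v_1,v_3\},\{v_0,v_2,v_4\}$; $D_1$: $\{v_0,v_1,v_2\},\{v_0,v_2,v_3\}$; $D_2$: $\{v_0,v_1,v_2\},\{v_0,v_1,v_3\}$. *)

(* Defs.v *)
From Stdlib Require Import Reals.
From mathcomp Require Import all_boot.
Set Implicit Arguments. Unset Strict Implicit. Unset Printing Implicit Defensive.

(* Omega_n = 'I_n, with v_i = i, cyclic order v_0 < v_1 < ... < v_{n-1} < v_0. *)

(* phi : 'I_k -> 'I_n preserves the cyclic order: after a suitable rotation of
   Omega_n, phi is strictly increasing. (Boolean, since all types are finite.) *)
Definition cyc_preserving (k n : nat) (phi : 'I_k -> 'I_n) : bool :=
  [exists r : 'I_n, forall i : 'I_k, forall j : 'I_k, (i < j)%N ==>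
    ((phi i + n - r) %% n < (phi j + n - r) %% n)%N].

Definition contains_copy (k n : nat) (H : {set {set 'I_n}}) (F : {set {set 'I_k}}) : bool :=
  [exists phi : {ffun 'I_k -> 'I_n}, [&& injectiveb phi, cyc_preserving phi &
    [forall e in F, phi @: e \in H]]].

Definition three_cgh (n : nat) (H : {set {set 'I_n}}) : bool :=
  [forall e in H, #|e| == 3].

Definition saturated (k n : nat) (F : {set {set 'I_k}}) (H : {set {set 'I_n}}) : bool :=
  [&& three_cgh H, ~~ contains_copy H F &
   [forall e : {set 'I_n}, (#|e| == 3) && (e \notin H) ==> contains_copy (e |: H) F]].

(* sat_cyc n F: minimum number of edges of an F-saturated 3-cgh on Omega_n.
   An F-saturated 3-cgh always exists (a maximal F-free 3-cgh), and it has at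
   most 'C(n,3) edges, so 'C(n,3) is a harmless neutral element for the min. *)
Definition sat_cyc (k : nat) (F : {set {set 'I_k}}) (n : nat) : nat :=
  \big[minn/'C(n, 3)]_(H : {set {set 'I_n}} | saturated F H) #|H|.

Definition v {k} (i : nat) : 'I_k.+1 := inord i.
Definition M1 : {set {set 'I_6}} := [set [set v 0; v 1; v 2]; [set v 3; v 4; v 5]].
Definition M2 : {set {set 'I_6}} := [set [set v 0; v 1; v 3]; [set v 2; v 4; v 5]].
Definition M3 : {set {set 'I_6}} := [set [set v 0; v 2; v 4]; [set v 1; v 3; v 5]].
Definition S1 : {set {set 'I_5}} := [set [set v 0; v 1; v 2]; [set v 0; v 3; v 4]].
Definition S2 : {set {set 'I_5}} := [set [set v 0; v 1; v 4]; [set v 0; v 2; v 3]].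
Definition S3 : {set {set 'I_5}} := [set [set v 0; v 1; v 3]; [set v 0; v 2; v 4]].
Definition D1 : {set {set 'I_4}} := [set [set v 0; v 1; v 2]; [set v 0; v 2; v 3]].
Definition D2 : {set {set 'I_4}} := [set [set v 0; v 1; v 2]; [set v 0; v 1; v 3]].

(* Asymptotic notation as n -> oo, for real-valued sequences
   (Stdlib reals, written with Rlt/Rle/Rmult to avoid nat-scope notations). *)
Definition bigO (f g : nat -> R) : Prop :=
  exists C : R, Rlt 0 C /\ exists N : nat, forall n, (N <= n)%N -> Rle (f n) (Rmult C (g n)).
Definition bigOmega (f g : nat -> R) : Prop :=
  exists c : R, Rlt 0 c /\ exists N : nat, forall n, (N <= n)%N -> Rle (Rmult c (g n)) (f n).
Definition bigTheta (f g : nat -> R) : Prop := bigO f g /\ bigOmega f g.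

Definition satR (k : nat) (F : {set {set 'I_k}}) : nat -> R := fun n => INR (sat_cyc F n).
Definition lin : nat -> R := fun n => INR n.
Definition quad : nat -> R := fun n => Rmult (INR n) (INR n).
Definition nlog2n : nat -> R := fun n => Rmult (INR n) (Rdiv (ln (INR n)) (ln 2)).

(* Main.v *)
Require Import Defs.
From Stdlib Require Import Reals Lra.
From mathcomp Require Import all_boot.
From mathcomp Require Import zify.
Set Implicit Arguments. Unset Strict Implicit. Unset Printing Implicit Defensive.

(** Call a triple dominated by a family [H] if adding it to [H] creates a copy of
    [F].  If [H] is [F]-free, every saturated extension of [H] consists of
    undominated triples, so an upper bound only needs an [F]-free family leaving few
    triples undominated:
    - [M1]: the single edge [{0, 1, 2}];  [M3]: all triples containing [0];
    - [D1]: all [{2i, 2i+1, y}] with [y > 2i+1];  [D2]: every [D2]-free family has at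
      most [n^2] edges, as [{a, b, c}] with [a < b < c] is determined by [a] and [b];
    - [M2]: the zigzag strip [{i, i+1, n-1-i}];  [S2]: all [{i, i+1, i+2}];
    - [S1]: both consecutive triples of each block [{4i, 4i+1, 4i+2, 4i+3}];
    - [S3]: all [{i, i+1, n-1}] and [{0, i, n-1}], which even gives [O(n)].
    For the lower bounds, a triple outside a saturated family conflicts with one of
    its edges.  For [S1], [S2], [S3] it meets this edge, so at most two vertices are
    isolated; for [D1], [D2] it shares a pair with it, so each edge accounts for at
    most [3n] triples.  For [M2] every [{a, a+1, a+2}] is an edge, for [M3] every
    [{a, a+1, x}], and for [M1] each [a] has some [b] such that all the [{a, b, x}]
    are edges. *)

(** * Triples of vertices and families of triples *)

(** Vertices are natural numbers, which keeps computations with them within reach of [lia]; values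
    not below [n] contribute nothing. *)
Definition tri (n a b c : nat) : {set 'I_n} :=
  [set x : 'I_n | [|| x == a :> nat, x == b :> nat | x == c :> nat]].

Lemma tri_rot n a b c : tri n a b c = tri n b c a.
Proof. by apply/setP => x; rewrite !inE orbC -orbA. Qed.

Lemma triE n (a b c : 'I_n) : tri n a b c = [set a; b; c].
Proof. by apply/setP => x; rewrite !inE -orbA. Qed.

Lemma imset3 (T U : finType) (f : T -> U) a b c :
  f @: [set a; b; c] = [set f a; f b; f c].
Proof. by rewrite !imsetU !imset_set1. Qed.

Lemma card_tri n a b c : a < b -> b < c -> c < n -> #|tri n a b c| = 3.
Proof.
move=> ab bc cn; have bn := ltn_trans bc cn; have an := ltn_trans ab bn.
rewrite (@triE n (Ordinal an) (Ordinal bn) (Ordinal cn)) -setUA cardsU1 cards2.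
rewrite !inE -!val_eqE /=.
by rewrite !(ltn_eqF ab) (ltn_eqF bc) (ltn_eqF (ltn_trans ab bc)).
Qed.

Lemma tri_ex n (e : {set 'I_n}) : #|e| = 3 ->
  exists a b c, [/\ a < b, b < c, c < n & e = tri n a b c].
Proof.
move=> e3; have : sorted ltn (map val (enum e)).
  rewrite (subseq_sorted ltn_trans _ (iota_ltn_sorted 0 n)) //.
  have -> : enum e = [seq x <- enum 'I_n | x \in e] by rewrite [in RHS]enumT.
  by rewrite -val_enum_ord map_subseq // filter_subseq.
have : size (enum e) = 3 by rewrite -cardE.
case E: (enum e) => [|a [|b [|c []]]] //= _ /and3P[ab bc _].
exists a, b, c; split => //; rewrite triE; apply/setP => x.
by rewrite -mem_enum E !inE orbA.
Qed.

Lemma tri_inj n a b c a' b' c' : a < b -> b < c -> c < n ->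
  a' < b' -> b' < c' -> c' < n -> tri n a b c = tri n a' b' c' ->
  [/\ a = a', b = b' & c = c'].
Proof.
move=> ab bc cn ab' bc' cn' /setP E.
have bn := ltn_trans bc cn; have an := ltn_trans ab bn.
have bn' := ltn_trans bc' cn'; have an' := ltn_trans ab' bn'.
have := E (Ordinal an); have := E (Ordinal bn); have := E (Ordinal cn).
have := E (Ordinal an'); have := E (Ordinal bn'); have := E (Ordinal cn').
by rewrite !inE /= !eqxx ?orbT /= => *; split; lia.
Qed.

Definition fam (n : nat) (P : nat -> nat -> nat -> bool) : {set {set 'I_n}} :=
  [set e : {set 'I_n} | [exists a : 'I_n, exists b : 'I_n, exists c : 'I_n,
     [&& a < b, b < c, P a b c & e == tri n a b c]]].

Lemma famP n (P : nat -> nat -> nat -> bool) (e : {set 'I_n}) : reflect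
  (exists a b c, [/\ a < b, b < c, c < n, P a b c & e = tri n a b c]) (e \in fam n P).
Proof.
rewrite inE; apply: (iffP existsP) => [[a /existsP[b /existsP[c]]]|].
  by case/and4P => ab bc Pabc /eqP->; exists a, b, c.
case=> a [b [c [ab bc cn Pabc ->]]]; have bn := ltn_trans bc cn.
exists (Ordinal (ltn_trans ab bn)); apply/existsP; exists (Ordinal bn).
by apply/existsP; exists (Ordinal cn); rewrite /= ab bc Pabc eqxx.
Qed.

Lemma mem_fam n P a b c : a < b -> b < c -> c < n -> (tri n a b c \in fam n P) = P a b c.
Proof.
move=> ab bc cn; apply/famP/idP => [[a' [b' [c' [ab' bc' cn' Pabc E]]]]|Pabc].
  by have [-> -> ->] := tri_inj ab bc cn ab' bc' cn' E.
by exists a, b, c.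
Qed.

Lemma three_cgh_fam n P : three_cgh (fam n P).
Proof.
apply/forall_inP => e /famP[a [b [c [ab bc cn _ ->]]]].
by rewrite card_tri.
Qed.

(** * Cyclic order *)

(** Strict cyclic order. For fixed [x] it is transitive in the other two arguments, so lists can be
    sorted by [cyc3 x]. *)
Definition cyc3 (x y z : nat) : bool :=
  [|| (x < y) && (y < z), (y < z) && (z < x) | (z < x) && (x < y)].

Lemma val_v k i : i <= k -> (v i : 'I_k.+1) = i :> nat.
Proof. exact: inordK. Qed.

Lemma modn_rot n x y : x < n -> y < n ->
  (y + n - x) %% n = if x <= y then y - x else y + n - x.
Proof.
move=> xn yn; case: leqP => xy; last by rewrite modn_small //; lia.
by rewrite -addnBAC // modnDr modn_small //; lia.
Qed.

Lemma cyc_preserving_inj k n (phi : 'I_k -> 'I_n) : cyc_preserving phi -> injective phi.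
Proof.
case/existsP => r /forallP phiP i j eq_ij; apply/val_inj/eqP.
have /forallP/(_ j) := phiP i; have /forallP/(_ i) := phiP j.
by rewrite eq_ij !ltnn !implybF; case: ltngtP.
Qed.

(* The witness of rotation can always be taken to be the image of the first point. *)
Lemma copy_intro k n (H : {set {set 'I_n}}) (s : seq nat) a b c a' b' c' :
  size s = k.+1 -> all (gtn n) s ->
  all (fun y => y != head 0 s) (behead s) -> sorted (cyc3 (head 0 s)) (behead s) ->
  all (geq k) [:: a; b; c; a'; b'; c'] ->
  tri n (nth 0 s a) (nth 0 s b) (nth 0 s c) \in H ->
  tri n (nth 0 s a') (nth 0 s b') (nth 0 s c') \in H ->
  contains_copy H [set [set (v a : 'I_k.+1); v b; v c]; [set v a'; v b'; v c']].
Proof.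
move=> sz sn sx scyc /and5P[ak bk ck ak' /and3P[bk' ck' _]] HA HB.
have n0 : 0 < n by case: s sn sz {sx scyc HA HB} => [|x s] /=; [|case/andP; lia].
pose phi := [ffun i : 'I_k.+1 => Ordinal (ltn_pmod (nth 0 s i) n0)].
have sln i : i <= k -> nth 0 s i < n.
  by move=> ik; move/allP: sn; apply; rewrite mem_nth // sz.
have phiE (i : 'I_k.+1) : phi i = nth 0 s i :> nat.
  by rewrite ffunE /= modn_small // sln // -ltnS.
have phi_im p q r : p <= k -> q <= k -> r <= k ->
    phi @: [set (v p : 'I_k.+1); v q; v r] = tri n (nth 0 s p) (nth 0 s q) (nth 0 s r).
  move=> pk qk rk; by rewrite imset3 -triE !phiE !val_v.
have cyc : cyc_preserving phi.
  apply/existsP; exists (phi ord0); apply/forallP => i; apply/forallP => j.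
  apply/implyP => ij; rewrite !phiE /=.
  have [ik jk] : i <= k /\ j <= k by split; rewrite -ltnS ltn_ord.
  rewrite !modn_rot ?sln //.
  case: s sz sx scyc sln {sn HA HB phi_im phi phiE} => //= x t [sz] /allP sx + sln.
  case: i j ij ik jk => [[|i] /= _] [[|j] /= _] //=.
    move=> _ _ jk'; have := sx _ (mem_nth 0 (n := j) (s := t) _); rewrite sz => /(_ jk').
    have := sln 0 isT; have /= := sln j.+1 jk'.
    by rewrite leqnn subnn; case: ifP; lia.
  move=> ij ik' jk' scyc; have tr : transitive (cyc3 x) by move=> p q r; rewrite /cyc3; lia.
  have := sorted_ltn_nth tr 0 scyc i j; rewrite !inE sz => /(_ ik' jk' ij).
  have := sln 0 isT; have /= := sln i.+1 ik'; have /= := sln j.+1 jk'.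
  by rewrite /cyc3; do ?case: ifP; lia.
have inj : injectiveb phi by apply/injectiveP/cyc_preserving_inj.
apply/existsP; exists phi; rewrite inj cyc /=.
by apply/forall_inP => e; rewrite !inE => /orP[] /eqP->; rewrite phi_im.
Qed.

(** Along the pattern the images at or after [r] come first, then those before [r], starting at
    index [c]. Listing the second group first makes the images increasing. *)
Lemma cyc_linear k n (phi : 'I_k.+1 -> 'I_n) : cyc_preserving phi ->
  exists (x : nat -> nat) m, [/\ m <= k, (forall i j, i < j <= k -> x i < x j),
     forall i, i <= k -> x i < n & forall i, i <= k -> phi (v i) = x ((i + m) %% k.+1) :> nat].
Proof.
case/existsP => r /forallP phiP.
pose p i := nat_of_ord (phi (v i)).
have pn i : p i < n by rewrite ltn_ord.
have pP i j : i < j <= k -> (if r <= p i then p i - r else p i + n - r) <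
    (if r <= p j then p j - r else p j + n - r).
  case/andP => ij jk; have /forallP/(_ (v j)) := phiP (v i).
  by rewrite !val_v ?(ltnW (leq_trans ij jk)) // ij !modn_rot.
have rn := ltn_ord r.
pose c := find (fun i => p i < r) (iota 0 k.+1).
have ck : c <= k.+1 by rewrite -[k.+1](size_iota 0) find_size.
have c_lt i : i < c -> r <= p i.
  move=> ic; have := before_find 0 ic; rewrite nth_iota ?(leq_trans ic) // add0n.
  by case: leqP.
have c_ge i : c <= i -> i <= k -> p i < r.
  move=> ci ik; have : has (fun i => p i < r) (iota 0 k.+1).
    by rewrite has_find size_iota (leq_ltn_trans ci).
  move/(nth_find 0); rewrite nth_iota -?/c ?(leq_ltn_trans ci) // add0n => pc.
  have [->//|ic] := eqVneq i c.
  have := pP c i; rewrite ik (ltn_neqAle c) eq_sym ic ci => /(_ isT).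
  by have := pn i; do ?case: ifP; lia.
pose x j := if j < k.+1 - c then p (j + c) else p (j - (k.+1 - c)).
(* If all images lie before [r], the shift is [0] instead of [k.+1], which keeps [m <= k]. *)
exists x, (if c == 0 then 0 else k.+1 - c); split.
- by case: eqP; lia.
- move=> i j ijk; rewrite /x; case: ifP => hi; case: ifP => hj; try lia.
  + have := pP (i + c) (j + c); have := c_ge (i + c); have := c_ge (j + c).
    by do ?case: ifP; lia.
  + have := c_ge (i + c); have := c_lt (j - (k.+1 - c)); lia.
  + have := pP (i - (k.+1 - c)) (j - (k.+1 - c)).
    have := c_lt (i - (k.+1 - c)); have := c_lt (j - (k.+1 - c)).
    by do ?case: ifP; lia.
- by move=> i ik; rewrite /x; case: ifP.
- move=> i ik; rewrite -[nat_of_ord _]/(p i) /x; case: eqP => c0.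
    by rewrite addn0 modn_small ?ltnS // c0 addn0 subn0 ltnS ik.
  case: (ltnP i c) => ic.
    rewrite modn_small; last by lia.
    by rewrite ifF; [congr p; lia | lia].
  have -> : i + (k.+1 - c) = (i - c) + k.+1 by lia.
  rewrite modnDr modn_small; last by lia.
  by rewrite ifT; [congr p; lia | lia].
Qed.

(** Reduces freeness to finitely many cases: an increasing list of vertices and one of its [k.+1]
    rotations. *)
Lemma copy_elim k n (H : {set {set 'I_n}}) a b c a' b' c' :
  all (geq k) [:: a; b; c; a'; b'; c'] ->
  contains_copy H [set [set (v a : 'I_k.+1); v b; v c]; [set v a'; v b'; v c']] ->
  exists (s : seq nat) m, [/\ size s = k.+1, m <= k, sorted ltn s, all (gtn n) s &
    let t := rot m s in tri n (nth 0 t a) (nth 0 t b) (nth 0 t c) \in H /\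
                        tri n (nth 0 t a') (nth 0 t b') (nth 0 t c') \in H].
Proof.
case/and5P=> ak bk ck ak' /and3P[bk' ck' _] /existsP[phi /and3P[_ cyc /forall_inP phiH]].
have [x [m [mk xlt xn phix]]] := cyc_linear cyc.
exists (mkseq x k.+1), m; split => //; first by rewrite size_mkseq.
- apply/(sortedP 0) => i; rewrite size_mkseq => ik.
  by rewrite !nth_mkseq ?(ltnW ik) //; apply: xlt; rewrite leqnn -ltnS.
- by apply/(all_nthP 0) => i; rewrite size_mkseq => ik; rewrite nth_mkseq //= xn.
have nthE i : i <= k -> nth 0 (rot m (mkseq x k.+1)) i = phi (v i).
  move=> ik; rewrite phix // nth_cat size_drop nth_drop size_mkseq.
  case: ltnP => im.
    by rewrite nth_mkseq addnC ?modn_small //; lia.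
  rewrite nth_take ?nth_mkseq; try lia.
  have -> : i + m = i - (k.+1 - m) + k.+1 by lia.
  by rewrite modnDr modn_small //; lia.
rewrite /= !nthE // !triE -!(imset3 phi).
by split; [exact: phiH (set21 _ _) | exact: phiH (set22 _ _)].
Qed.

(** * Saturation *)

Lemma contains_copyS k n (F : {set {set 'I_k}}) (H H' : {set {set 'I_n}}) :
  H \subset H' -> contains_copy H F -> contains_copy H' F.
Proof.
move=> /subsetP sH /existsP[phi /and3P[inj cyc /forall_inP HP]].
by apply/existsP; exists phi; rewrite inj cyc; apply/forall_inP => e /HP/sH.
Qed.

Lemma saturated_extension k n (F : {set {set 'I_k}}) (H0 : {set {set 'I_n}}) :
  three_cgh H0 -> ~~ contains_copy H0 F ->
  exists2 H, saturated F H & H0 \subset H.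
Proof.
move=> H03 H0F; pose P (H : {set {set 'I_n}}) := three_cgh H && ~~ contains_copy H F.
have PH0 : P H0 by rewrite /P H03.
have [H /maxsetP[/andP[H3 HF] Hmax] H0H] := maxset_exists (P := P) PH0.
exists H => //; rewrite /saturated H3 HF; apply/forall_inP => e /andP[e3 eH].
apply: contraR eH => eHF; rewrite -(Hmax (e |: H)) ?setU11 ?subsetUr //.
rewrite /P eHF andbT; apply/forall_inP => f /setU1P[->//|].
exact: (forall_inP H3).
Qed.

Lemma sat_cyc_le k n (F : {set {set 'I_k}}) (H : {set {set 'I_n}}) :
  saturated F H -> sat_cyc F n <= #|H|.
Proof.
move=> HF; rewrite /sat_cyc; have := mem_index_enum H.
elim: (index_enum _) => // G s IHs; rewrite inE big_cons => /predU1P[<-|/IHs le_s].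
  by rewrite HF geq_minl.
by case: ifP => // _; rewrite geq_min le_s orbT.
Qed.

(** The neutral element ['C(n, 3)] of the minimum must obey the bound too; it does, since a
    saturated family exists above the empty one and has at most that many edges. *)
Lemma sat_cyc_ge k n (F : {set {set 'I_k}}) m C : F != set0 ->
  (forall H : {set {set 'I_n}}, saturated F H -> m <= C * #|H|) -> m <= C * sat_cyc F n.
Proof.
move=> F0 mP; rewrite /sat_cyc; apply: (big_ind (fun s => m <= C * s)) => //.
  have H03 : three_cgh (set0 : {set {set 'I_n}}).
    by apply/forall_inP => e; rewrite inE.
  have H0F : ~~ contains_copy (set0 : {set {set 'I_n}}) F.
    have [e eF] := set0Pn _ F0; apply/negP => /existsP[phi /and3P[_ _ /forall_inP]].
    by move/(_ e eF); rewrite inE.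
  have [H HF _] := saturated_extension H03 H0F.
  apply: leq_trans (mP H HF) _; rewrite leq_mul2l -[n in 'C(n, _)]card_ord.
  rewrite -card_draws subset_leq_card ?orbT //; apply/subsetP => e eH.
  by rewrite inE; case/and3P: HF => /forall_inP/(_ e eH).
by move=> s t ms mt; rewrite /minn; case: ifP.
Qed.

(** The map [g] enumerates the undominated triples, and a saturated extension of [fam n P] lies in
    its image. *)
Lemma sat_cyc_upper k n (F : {set {set 'I_k}}) P
    K1 K2 K3 (g : nat -> nat -> nat -> {set 'I_n}) :
  ~~ contains_copy (fam n P) F ->
  (forall a b c, a < b -> b < c -> c < n ->
     contains_copy (tri n a b c |: fam n P) F \/
     exists i j l, [/\ i < K1, j < K2, l < K3 & tri n a b c = g i j l]) ->
  sat_cyc F n <= K1 * K2 * K3.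
Proof.
move=> PF gP; have [H HF PH] := saturated_extension (three_cgh_fam n P) PF.
apply: leq_trans (sat_cyc_le HF) _.
pose h (t : 'I_K1 * 'I_K2 * 'I_K3) := g t.1.1 t.1.2 t.2.
have -> : K1 * K2 * K3 = #|[set: 'I_K1 * 'I_K2 * 'I_K3]|.
  by rewrite cardsT !card_prod !card_ord.
apply: leq_trans (leq_imset_card h _); apply/subset_leq_card/subsetP => e eH.
case/and3P: HF => /forall_inP/(_ e eH)/eqP/tri_ex[a [b [c [ab bc cn eE]]]] HF _.
have [cF|[i [j [l [iK jK lK E]]]]] := gP a b c ab bc cn.
  by case/negP: HF; apply: contains_copyS cF; rewrite subUset sub1set -eE eH.
by apply/imsetP; exists (Ordinal iK, Ordinal jK, Ordinal lK) => //; rewrite eE E.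
Qed.

(** The new copy uses [e] for exactly one pattern edge: for both is excluded by injectivity, for
    none by freeness of [H]. *)
Lemma saturated_conflict k n (A B : {set 'I_k}) (H : {set {set 'I_n}}) (e : {set 'I_n}) :
  A != B -> saturated [set A; B] H -> #|e| = 3 -> e \notin H ->
  exists2 f, f \in H & exists phi : 'I_k -> 'I_n, cyc_preserving phi /\
    ((phi @: A = e /\ phi @: B = f) \/ (phi @: A = f /\ phi @: B = e)).
Proof.
move=> AB /and3P[H3 HF /forall_inP satH] e3 eH.
have /existsP[phi /and3P[inj cyc /forall_inP phiP]] : contains_copy (e |: H) [set A; B].
  by apply: satH; rewrite e3 eqxx.
have := phiP A (set21 _ _); have := phiP B (set22 _ _).
case/setU1P => [Be|BH] /setU1P[Ae|AH].
- by case/eqP: AB; apply: (imset_inj (injectiveP _ inj)); rewrite Ae Be.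
- by exists (phi @: A) => //; exists phi; split => //; right.
- by exists (phi @: B) => //; exists phi; split => //; left.
case/negP: HF; apply/existsP; exists phi; rewrite inj cyc.
by apply/forall_inP => x; rewrite !inE => /orP[] /eqP->.
Qed.

(** * Upper bounds *)

Ltac fam_pred H :=
  first [ rewrite mem_fam in H; [| lia | lia | lia]
        | rewrite tri_rot mem_fam in H; [| lia | lia | lia]
        | rewrite -tri_rot mem_fam in H; [| lia | lia | lia] ].

(** Splits into all rotations of the list from [copy_elim]; each is refuted by arithmetic on the
    predicate of the family. *)
Ltac no_copy :=
  let s := fresh in let m := fresh in
  let sz := fresh in let mk := fresh in let srt := fresh in let sn := fresh in
  let HA := fresh in let HB := fresh in
  apply/negP => /copy_elim[] // s [m [sz mk srt sn [HA HB]]];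
  do ! (case: s sz srt sn HA HB => [|? s] //= sz srt sn HA HB);
  do ! (case: m mk HA HB => [|m] //= mk HA HB);
  rewrite /= in HA HB; fam_pred HA; fam_pred HB; lia.

Lemma M1_free n : ~~ contains_copy
  (fam n (fun a b c => [&& a == 0, b == 1 & c == 2])) M1.
Proof. by no_copy. Qed.

(** Of two disjoint strip triples the inner one lies in a single gap of the outer one, whereas [M2]
    needs vertices in two gaps. *)
Lemma M2_free n : ~~ contains_copy
  (fam n (fun a b c => (b == a.+1) && (c == n.-1 - a))) M2.
Proof. by no_copy. Qed.

Lemma M3_free n : ~~ contains_copy (fam n (fun a b c => a == 0)) M3.
Proof. by no_copy. Qed.

(** Two edges are disjoint or, within one block, share two vertices; never exactly one. *)
Lemma S1_free n : ~~ contains_copy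
  (fam n (fun a b c => [&& a %% 4 <= 1, b == a.+1 & c == a.+2])) S1.
Proof. by no_copy. Qed.

(** Two consecutive triples with exactly one common vertex form an [S1]. *)
Lemma S2_free n : ~~ contains_copy
  (fam n (fun a b c => (b == a.+1) && (c == a.+2))) S2.
Proof. by no_copy. Qed.

(** All edges contain [n-1], and the remaining pairs [{i, i+1}] and [{0, i}] never cross, as the
    pairs in [S3] do. *)
Lemma S3_free n : ~~ contains_copy
  (fam n (fun a b c => (c == n.-1) && ((a == 0) || (b == a.+1)))) S3.
Proof. by no_copy. Qed.

(** Edges sharing two vertices share some [{2i, 2i+1}], which has no vertex on one side, while [D1]
    needs one on each side. *)
Lemma D1_free n : ~~ contains_copy
  (fam n (fun a b c => ~~ odd a && (b == a.+1))) D1.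
Proof. by no_copy. Qed.

Ltac tri_mem :=
  rewrite in_setU1; apply/orP;
  first [ left; apply/eqP; first [ reflexivity | exact: tri_rot | symmetry; exact: tri_rot ]
        | right; first [ rewrite mem_fam; lia
                       | rewrite tri_rot mem_fam; lia
                       | rewrite -tri_rot mem_fam; lia ] ].

(** The list [s] gives the images of [v 0], [v 1], ... in this order. *)
Ltac copy s :=
  apply: (@copy_intro _ _ _ s);
  [ by [] | rewrite /=; lia | rewrite /=; lia | rewrite /= /cyc3; lia | by []
  | rewrite /=; tri_mem | rewrite /=; tri_mem ].

Lemma sat_M1_le n : sat_cyc M1 n <= 3 * n * n.
Proof.
apply: (sat_cyc_upper (g := tri n) (M1_free n)) => a b c ab bc cn.
case: (ltnP a 3) => a3; first by right; exists a, b, c; split => //; lia.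
by left; copy [:: 0; 1; 2; a; b; c].
Qed.

Lemma sat_M3_le n : sat_cyc M3 n <= 3 * n * n.
Proof.
(* The undominated triples contain [0] or have [b = a+1] or [c = b+1]; the index [i] tells which. *)
pose g i j l := match i with
  0 => tri n 0 j l | 1 => tri n j j.+1 l | _ => tri n j l l.+1 end.
apply: (sat_cyc_upper (g := g) (M3_free n)) => a b c ab bc cn.
have [->|a0] := posnP a; first by right; exists 0, b, c; split => //; lia.
have [->|ab1] := eqVneq b a.+1; first by right; exists 1, a, c; split => //; lia.
have [->|bc1] := eqVneq c b.+1; first by right; exists 2, a, b; split => //; lia.
by left; copy [:: 0; a; a.+1; b; b.+1; c].
Qed.

Lemma sat_D1_le n : sat_cyc D1 n <= n * n * 1.
Proof.
apply: (sat_cyc_upper (g := fun i j l => tri n i i.+1 j) (D1_free n)) => a b c ab bc cn.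
have [oa|ea] := boolP (odd a); first by left; copy [:: a; b; c; a.-1].
have [->|ab1] := eqVneq b a.+1; first by right; exists a, c, 0; split => //; lia.
by left; copy [:: a; a.+1; b; c].
Qed.

Lemma sat_S2_le n : sat_cyc S2 n <= n * 3 * 1.
Proof.
(* A vertex [x] other than [0] and [n-1] with both neighbours outside the triple gives a copy with
   [{x-1, x, x+1}]. The three types below are those without such an [x]. *)
pose g i j (l : nat) := match j with
  0 => tri n i i.+1 i.+2 | 1 => tri n i i.+1 n.-1 | _ => tri n 0 i i.+1 end.
apply: (sat_cyc_upper (g := g) (S2_free n)) => a b c ab bc cn.
have [->|ab1] := eqVneq b a.+1.
  have [->|bc1] := eqVneq c a.+2; first by right; exists a, 0, 0; split => //; lia.
  have [->|cn1] := eqVneq c n.-1; first by right; exists a, 1, 0; split => //; lia.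
  by left; copy [:: c; c.+1; a; a.+1; c.-1].
have [->|bc1] := eqVneq c b.+1; last by left; copy [:: b; b.+1; c; a; b.-1].
have [->|a0] := posnP a; first by right; exists b, 2, 0; split => //; lia.
by left; copy [:: a; a.+1; b; b.+1; a.-1].
Qed.

Lemma sat_S3_le n : sat_cyc S3 n <= n * 3 * 1.
Proof.
pose g i j (l : nat) := match j with
  0 => tri n i i.+1 i.+2 | 1 => tri n i i.+1 n.-1 | _ => tri n 0 i n.-1 end.
apply: (sat_cyc_upper (g := g) (S3_free n)) => a b c ab bc cn.
have [->|cn1] := eqVneq c n.-1.
  have [->|a0] := posnP a; first by right; exists b, 2, 0; split => //; lia.
  have [->|ab1] := eqVneq b a.+1; first by right; exists a, 1, 0; split => //; lia.
  by left; copy [:: n.-1; 0; a; a.+1; b].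
have [->|bc1] := eqVneq c b.+1; last by left; copy [:: b; b.+1; c; n.-1; a].
have [->|ab1] := eqVneq b a.+1; first by right; exists a, 0, 0; split => //; lia.
by left; copy [:: b; b.+1; n.-1; a; b.-1].
Qed.

Lemma sat_M2_le n : sat_cyc M2 n <= n * 18 * 18.
Proof.
(* [r] is the position along the strip: [x] and [n-1-x] face each other.  The
   undominated triples have their vertices at positions at most 4 apart, and
   [pt x] enumerates the vertices that close to [x]. *)
pose r x := minn x (n.-1 - x).
pose pt i j := let p := r i + j %/ 2 - 4 in if odd j then n.-1 - p else p.
have ptP x y : x < n -> y < n -> r y <= r x + 4 -> r x <= r y + 4 ->
    exists2 j, j < 18 & pt x j = y.
  move=> xn yn h1 h2; exists (2 * (r y + 4 - r x) + (y != r y)); first by lia.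
  rewrite /pt; have -> : (2 * (r y + 4 - r x) + (y != r y)) %/ 2 = r y + 4 - r x by lia.
  by move: h1 h2; rewrite /r; case: ifP; lia.
apply: (sat_cyc_upper (g := fun i j l => tri n i (pt i j) (pt i l)) (M2_free n)).
move=> a b c ab bc cn; have bn := ltn_trans bc cn; have an := ltn_trans ab bn.
(* The positions [i] and [i+1] of the strip are free and separate the vertices of the triple. *)
pose sep i := [&& all (fun x => (r x != i) && (r x != i.+1)) [:: a; b; c],
  has (fun x => r x < i) [:: a; b; c] & has (fun x => i.+1 < r x) [:: a; b; c]].
(* Between positions at least 5 apart lie two disjoint pairs of consecutive positions; the third
   vertex can spoil only one of them. *)
have [near|[i sepi]] : [&& r b <= r a + 4, r a <= r b + 4, r c <= r a + 4 & r a <= r c + 4] \/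
    exists i, sep i.
- have : [|| [&& r b <= r a + 4, r a <= r b + 4, r c <= r a + 4 & r a <= r c + 4],
    sep (r a).+1, sep (r b).+1 | sep (r c).+1] by rewrite /sep /=; lia.
  case/or4P; first by left.
  - by right; exists (r a).+1.
  - by right; exists (r b).+1.
  by right; exists (r c).+1.
- case/and4P: near => h1 h2 h3 h4.
  have [j jK jE] := ptP a b an bn h1 h2; have [l lK lE] := ptP a c an cn h3 h4.
  by right; exists a, j, l; rewrite jE lE.
left; have side x : x < n -> r x != i -> r x != i.+1 ->
    [|| (x < i) && (r x < i), [&& i.+1 < x, x < n.-1 - i & i.+1 < r x]
      | (n.-1 - i < x) && (r x < i)].
  by rewrite /r; lia.
(* The triple meets both gaps of [{i, i+1, n-1-i}] that are nonempty; each of the five distributions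
   is an [M2]. *)
have {sepi} : [|| [&& a < i, i.+1 < b & c < n.-1 - i],
    [&& i.+1 < a, b < n.-1 - i & n.-1 - i < c],
    [&& b < i, i.+1 < c & c < n.-1 - i],
    [&& a < i, i.+1 < b, b < n.-1 - i & n.-1 - i < c] |
    [&& i.+1 < a, a < n.-1 - i & n.-1 - i < b]].
  case/and3P: sepi => /and4P[/andP[a1 a2] /andP[b1 b2] /andP[c1 c2] _].
  move: (side a an a1 a2) (side b bn b1 b2) (side c cn c1 c2) => /=.
  by do 3!case/or3P=> /andP[? ?]; lia.
case/or4P; last case/orP; move=> ?.
- by copy [:: b; c; n.-1 - i; a; i; i.+1].
- by copy [:: a; b; n.-1 - i; c; i; i.+1].
- by copy [:: i; i.+1; c; n.-1 - i; a; b].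
- by copy [:: i; i.+1; b; n.-1 - i; c; a].
- by copy [:: i; i.+1; a; n.-1 - i; b; c].
Qed.

(* [u] lies in a full block [4i, 4i+1, 4i+2, 4i+3] that misses [y] and [z]. *)
Lemma S1_dominated n u y z : y < n -> z < n -> cyc3 u y z ->
  [&& u %/ 4 < n %/ 4, y %/ 4 != u %/ 4 & z %/ 4 != u %/ 4] ->
  contains_copy (tri n u y z |:
    fam n (fun a b c => [&& a %% 4 <= 1, b == a.+1 & c == a.+2])) S1.
Proof.
rewrite /cyc3 => yn zn uyz lone; case: (leqP (u %% 4) 1) => u4.
  by copy [:: u; u.+1; u.+2; y; z].
by copy [:: u; y; z; u.-2; u.-1].
Qed.

Lemma sat_S1_le n : sat_cyc S1 n <= n * 4 * 7.
Proof.
(* In an undominated triple [a] and [b] share a block, and [c] lies in it or among the at most three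
   vertices of the incomplete last block; the latter case uses [l = 4, 5, 6]. *)
pose g i j l := tri n i (i + j) (if l < 4 then i + l else n + 3 - l).
apply: (sat_cyc_upper (g := g) (S1_free n)) => a b c ab bc cn.
have bn := ltn_trans bc cn; have an := ltn_trans ab bn.
pose lone u y z := [&& u %/ 4 < n %/ 4, y %/ 4 != u %/ 4 & z %/ 4 != u %/ 4].
have [?|Na] := boolP (lone a b c).
  by left; apply: S1_dominated => //; rewrite /cyc3 ab bc.
have [?|Nb] := boolP (lone b c a).
  by left; rewrite tri_rot; apply: S1_dominated => //; rewrite /cyc3 ab bc ?orbT.
have [?|Nc] := boolP (lone c a b).
  by left; rewrite -tri_rot; apply: S1_dominated => //; rewrite /cyc3 ab bc ?orbT.
right; exists a, (b - a), (if c - a < 4 then c - a else n + 3 - c).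
rewrite /g; split => //; try by move: Na Nb Nc; rewrite /lone; do ?case: ifP; lia.
rewrite subnKC ?(ltnW ab) //; congr (tri n a b _).
by move: Na Nb Nc; rewrite /lone; do ?case: ifP; lia.
Qed.

Lemma sat_D2_le n : sat_cyc D2 n <= n * n.
Proof.
have H0 : ~~ contains_copy (fam n (fun _ _ _ => false)) D2 by no_copy.
have [H HF _] := saturated_extension (three_cgh_fam _ _) H0.
apply: leq_trans (sat_cyc_le HF) _; case/and3P: HF => /forall_inP H3 HF _.
(* Picks an edge with two smallest vertices [x.1 < x.2], or [set0] if there is none; freeness makes
   this edge unique. *)
pose g (x : 'I_n * 'I_n) := odflt set0 [pick e in H |
  [exists c : 'I_n, [&& x.1 < x.2, x.2 < c & e == tri n x.1 x.2 c]]].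
have <- : #|[set: 'I_n * 'I_n]| = n * n by rewrite cardsT card_prod card_ord.
apply: leq_trans (leq_imset_card g _); apply/subset_leq_card/subsetP => e eH.
have [a [b [c [ab bc cn eE]]]] := tri_ex (eqP (H3 e eH)).
have bn := ltn_trans bc cn; have an := ltn_trans ab bn.
apply/imsetP; exists (Ordinal an, Ordinal bn); rewrite ?inE // /g.
case: pickP => [f /andP[fH /existsP[d /and3P[_ /= bd /eqP fE]]]|/(_ e)]; last first.
  by rewrite eH => /existsP[]; exists (Ordinal cn); rewrite /= ab bc eE eqxx.
have [dc|cd|cd] := ltngtP c d; last by rewrite eE cd /= fE.
  case/negP: HF; apply: (@copy_intro _ _ _ [:: a; b; c; nat_of_ord d]) => //=.
  - by have := ltn_ord d; lia.
  - by lia.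
  - by rewrite /cyc3; lia.
  - by rewrite -eE.
  by rewrite -fE.
case/negP: HF; apply: (@copy_intro _ _ _ [:: a; b; nat_of_ord d; c]) => //=.
- by lia.
- by lia.
- by rewrite /cyc3; lia.
- by rewrite -fE.
by rewrite -eE.
Qed.

(** * Lower bounds *)

(** Three vertices outside [cover H] would form a triple disjoint from every edge, but a conflict
    shares the image of [x]. *)
Lemma sat_lower_vertex k n (A B : {set 'I_k}) (H : {set {set 'I_n}}) x :
  A != B -> x \in A -> x \in B -> saturated [set A; B] H -> n <= 3 * #|H| + 2.
Proof.
move=> AB xA xB satH; have /and3P[/forall_inP H3 _ _] := satH.
have HC : #|cover H| <= 3 * #|H|.
  apply: leq_trans (leq_card_cover H) _; rewrite (eq_bigr (fun=> 3)) => [|e /H3/eqP//].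
  by rewrite sum_nat_const mulnC.
rewrite leqNgt; apply/negP => n_gt; have C3 : 2 < #|~: cover H|.
  by have := cardsC (cover H); rewrite card_ord; lia.
have : 0 < #|[set e : {set 'I_n} | e \subset ~: cover H & #|e| == 3]|.
  by rewrite cards_draws bin_gt0.
case/card_gt0P => e; rewrite inE => /andP[/subsetP eC /eqP e3].
have He f y : f \in H -> y \in e -> y \notin f.
  move=> fH /eC; rewrite inE; apply: contraNN => yf.
  by apply/bigcupP; exists f.
have eH : e \notin H.
  apply/negP => eH; have /card_gt0P[y ye] : 0 < #|e| by rewrite e3.
  by have := He _ _ eH ye; rewrite ye.
have [f fH [phi [_ []]]] := saturated_conflict AB satH e3 eH.
  move=> [Ae Bf]; have := He f (phi x) fH.
  by rewrite -Ae -Bf !imset_f // => /(_ isT).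
move=> [Af Be]; have := He f (phi x) fH.
by rewrite -Af -Be !imset_f // => /(_ isT).
Qed.

(* A triple sharing two vertices with [f] arises from [f] by replacing one of its
   three vertices. *)
Lemma sat_lower_pair k n (A B : {set 'I_k}) (H : {set {set 'I_n}}) x y :
  A != B -> x != y -> [set x; y] \subset A :&: B -> saturated [set A; B] H ->
  'C(n, 3) <= 3 * n * #|H|.
Proof.
move=> AB xy xyAB satH; have /and3P[/forall_inP H3 _ _] := satH.
pose g (t : {set 'I_n} * ('I_3 * 'I_n)) := t.2.2 |: (t.1 :\ nth t.2.2 (enum t.1) t.2.1).
rewrite -[n in 'C(n, _)]card_ord -card_draws.
have <- : #|setX H [set: 'I_3 * 'I_n]| = 3 * n * #|H|.
  by rewrite cardsX cardsT card_prod !card_ord mulnC.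
apply: leq_trans (leq_imset_card g _); apply/subset_leq_card/subsetP => e.
rewrite inE => /eqP e3.
suff [f [w [u [fH uf ->]]]] : exists f w u, [/\ f \in H, u \in f & e = w |: (f :\ u)].
  have ui : index u (enum f) < 3.
    by rewrite -(eqP (H3 f fH)) cardE index_mem mem_enum.
  apply/imsetP; exists (f, (Ordinal ui, w)); first by rewrite !inE fH.
  by rewrite /g /= nth_index // mem_enum.
have [eH|eH] := boolP (e \in H).
  (* An edge of [H] arises from itself by replacing [u] with [u]. *)
  have /card_gt0P[u ue] : 0 < #|e| by rewrite e3.
  by exists e, u, u; rewrite setD1K.
have [f fH [phi [cyc phiAB]]] := saturated_conflict AB satH e3 eH.
have f3 := eqP (H3 f fH); exists f.
have pe : #|[set phi x; phi y]| = 2.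
  by rewrite cards2 (inj_eq (cyc_preserving_inj cyc)) xy.
have [pE pF] : [set phi x; phi y] \subset e /\ [set phi x; phi y] \subset f.
  move: xyAB; rewrite subsetI !subUset !sub1set => /andP[/andP[xA yA] /andP[xB yB]].
  by case: phiAB => [[<- <-]|[<- <-]]; rewrite !imset_f.
have third (h : {set 'I_n}) : #|h| = 3 -> [set phi x; phi y] \subset h ->
    exists2 u, u \in h & h :\ u = [set phi x; phi y].
  move=> h3 ph; have /cards1P[u hu] : #|h :\: [set phi x; phi y]| == 1.
    by rewrite cardsD (setIidPr ph) h3 pe.
  exists u; first by have := set11 u; rewrite -hu inE => /andP[].
  by rewrite -hu setDDr setDv set0U (setIidPr ph).
have [w we ew] := third e e3 pE; have [u uf fu] := third f f3 pF.
by exists w, u; split; rewrite // fu -ew setD1K.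
Qed.

(** The vertex [v i] must lie in exactly one of the two pattern edges. *)
Ltac pattern_neq i :=
  apply/eqP => /setP/(_ (v i)); rewrite !inE -!val_eqE /= !inordK.

Ltac in_pattern := by rewrite !inE eqxx ?orbT.

Lemma sat_S1_ge n : n - 2 <= 3 * sat_cyc S1 n.
Proof.
apply: sat_cyc_ge => [|H]; first by apply/set0Pn; eexists; exact: set21.
move/(@sat_lower_vertex _ _ _ _ _ (v 0)) => h.
have := h ltac:(pattern_neq 1) ltac:(in_pattern) ltac:(in_pattern); lia.
Qed.

Lemma sat_S2_ge n : n - 2 <= 3 * sat_cyc S2 n.
Proof.
apply: sat_cyc_ge => [|H]; first by apply/set0Pn; eexists; exact: set21.
move/(@sat_lower_vertex _ _ _ _ _ (v 0)) => h.
have := h ltac:(pattern_neq 1) ltac:(in_pattern) ltac:(in_pattern); lia.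
Qed.

Lemma sat_S3_ge n : n - 2 <= 3 * sat_cyc S3 n.
Proof.
apply: sat_cyc_ge => [|H]; first by apply/set0Pn; eexists; exact: set21.
move/(@sat_lower_vertex _ _ _ _ _ (v 0)) => h.
have := h ltac:(pattern_neq 1) ltac:(in_pattern) ltac:(in_pattern); lia.
Qed.

Lemma sat_D1_ge n : 'C(n, 3) <= 3 * n * sat_cyc D1 n.
Proof.
apply: sat_cyc_ge => [|H]; first by apply/set0Pn; eexists; exact: set21.
apply: (@sat_lower_pair _ _ _ _ _ (v 0) (v 2)); first by pattern_neq 1.
  by rewrite -val_eqE /= !inordK.
by rewrite subsetI !subUset !sub1set !inE !eqxx ?orbT.
Qed.

Lemma sat_D2_ge n : 'C(n, 3) <= 3 * n * sat_cyc D2 n.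
Proof.
apply: sat_cyc_ge => [|H]; first by apply/set0Pn; eexists; exact: set21.
apply: (@sat_lower_pair _ _ _ _ _ (v 0) (v 1)); first by pattern_neq 2.
  by rewrite -val_eqE /= !inordK.
by rewrite subsetI !subUset !sub1set !inE !eqxx ?orbT.
Qed.

(** * Triples forced into the family for [M2] and [M3] *)

Lemma cyc_preserving_cyc3 k n (phi : 'I_k.+1 -> 'I_n) i j l :
  cyc_preserving phi -> i < j -> j < l -> l <= k ->
  cyc3 (phi (v i)) (phi (v j)) (phi (v l)).
Proof.
case/existsP => r /forallP phiP ij jl lk.
have step s t : s < t -> t <= k -> (phi (v s) + n - r) %% n < (phi (v t) + n - r) %% n.
  move=> st tk; have /forallP/(_ (v t)) := phiP (v s).
  by rewrite !val_v ?(ltnW (leq_trans st tk)) // st.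
have jk := ltnW (leq_trans jl lk); move: (step i j ij jk) (step j l jl lk).
rewrite !modn_rot //; have := ltn_ord (phi (v i)); have := ltn_ord (phi (v j)).
by have := ltn_ord (phi (v l)); rewrite /cyc3; do ?case: ifP; lia.
Qed.

Lemma mem_pattern k a b c i : a <= k -> b <= k -> c <= k -> i <= k ->
  (v i \in [set (v a : 'I_k.+1); v b; v c]) = [|| i == a, i == b | i == c].
Proof. by move=> *; rewrite !inE -!val_eqE /= !val_v // orbA. Qed.

(** Each edge of [M2] has vertices of the other in two of its gaps, but [{a, a+1, a+2}] has only one
    gap that can hold any. *)
Lemma M2_consecutive n (H : {set {set 'I_n}}) a : saturated M2 H -> a.+2 < n ->
  tri n a a.+1 a.+2 \in H.
Proof.
move=> satH an; apply/negPn/negP => eH.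
have neqAB : [set (v 0 : 'I_6); v 1; v 3] != [set v 2; v 4; v 5] by pattern_neq 0.
have e3 : #|tri n a a.+1 a.+2| = 3 by rewrite card_tri.
have [f fH [phi [cyc phiAB]]] := saturated_conflict neqAB satH e3 eH.
have inj := cyc_preserving_inj cyc.
have memE (A : {set 'I_6}) i : phi @: A = tri n a a.+1 a.+2 ->
    (a <= phi (v i) <= a.+2) = (v i \in A).
  by move=> AE; rewrite -(mem_imset _ _ inj) AE inE; lia.
move: (cyc_preserving_cyc3 (i := 0) (j := 1) (l := 2) cyc isT isT isT).
move: (cyc_preserving_cyc3 (i := 0) (j := 2) (l := 3) cyc isT isT isT).
move: (cyc_preserving_cyc3 (i := 0) (j := 3) (l := 4) cyc isT isT isT).
move: (cyc_preserving_cyc3 (i := 0) (j := 4) (l := 5) cyc isT isT isT).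
case: phiAB => [[/memE E _]|[_ /memE E]].
all: move: (E 0) (E 1) (E 2) (E 3) (E 4) (E 5); rewrite !mem_pattern //=.
all: rewrite /cyc3; lia.
Qed.

Lemma sat_M2_ge n : n - 2 <= 1 * sat_cyc M2 n.
Proof.
apply: sat_cyc_ge => [|H satH]; first by apply/set0Pn; eexists; exact: set21.
pose g (i : 'I_(n - 2)) := tri n i i.+1 i.+2.
have ginj : injective g.
  move=> i j gij; apply: val_inj; have [ni nj] := (ltn_ord i, ltn_ord j).
  have [i2 j2] : i.+2 < n /\ j.+2 < n by lia.
  by case: (tri_inj (ltnSn _) (ltnSn _) i2 (ltnSn _) (ltnSn _) j2 gij).
rewrite mul1n -[n - 2]card_ord -cardsT -(card_imset _ ginj).
apply/subset_leq_card/subsetP => e /imsetP[i _ ->].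
by apply: M2_consecutive => //; have := ltn_ord i; lia.
Qed.

(** Double counting of incidences: every vertex has degree at least [n - 2]. *)
Lemma link_lower n (H : {set {set 'I_n}}) : three_cgh H ->
  (forall a, exists2 b, b != a & forall x, x != a -> x != b -> [set a; b; x] \in H) ->
  n * (n - 2) <= 3 * #|H|.
Proof.
move=> /forall_inP H3 Hab.
have <- : \sum_(e in H) \sum_(a in e) 1 = 3 * #|H|.
  rewrite (eq_bigr (fun=> 3)) => [|e /H3/eqP <-]; last by rewrite sum1_card.
  by rewrite sum_nat_const mulnC.
rewrite (exchange_big_dep predT) //= -{1}[n]card_ord -sum_nat_const.
apply: leq_sum => a _; rewrite sum1_card; have [b ba bP] := Hab a.
pose g x := [set a; b; x].
have ginj : {in ~: [set a; b] &, injective g}.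
  move=> x y; rewrite !inE !negb_or => /andP[xa xb] _ /setP/(_ x).
  by rewrite !inE eqxx orbT (negbTE xa) (negbTE xb) /= => /esym/eqP.
have <- : #|~: [set a; b]| = n - 2.
  by have := cardsC [set a; b]; rewrite card_ord cards2 eq_sym ba; lia.
rewrite -(card_in_imset ginj); apply/subset_leq_card/subsetP => e /imsetP[x + ->{e}].
rewrite !inE negb_or => /andP[xa xb]; rewrite unfold_in /= bP //.
by rewrite !inE eqxx.
Qed.

(** The edges of [M3] alternate, so a triple containing [a] and its cyclic successor [b] conflicts
    with nothing. *)
Lemma sat_M3_ge n : 1 < n -> n * (n - 2) <= 3 * sat_cyc M3 n.
Proof.
move=> n1; apply: sat_cyc_ge => [|H satH]; first by apply/set0Pn; eexists; exact: set21.
have /and3P[H3 _ _] := satH; apply: link_lower => // a.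
have ltb : (if a.+1 < n then a.+1 else 0) < n by case: ifP; lia.
pose b := Ordinal ltb;
have ba : b != a by rewrite -val_eqE /=; case: ifP; have := ltn_ord a; lia.
exists b => // x xa xb; apply/negPn/negP => eH.
have neqAB : [set (v 0 : 'I_6); v 2; v 4] != [set v 1; v 3; v 5] by pattern_neq 0.
have e3 : #|[set a; b; x]| = 3.
  by rewrite -setUA cardsU1 !inE negb_or eq_sym ba eq_sym xa cards2 eq_sym xb.
have [f fH [phi [cyc phiAB]]] := saturated_conflict neqAB satH e3 eH.
move: (cyc_preserving_cyc3 (i := 0) (j := 1) (l := 2) cyc isT isT isT).
move: (cyc_preserving_cyc3 (i := 0) (j := 2) (l := 3) cyc isT isT isT).
move: (cyc_preserving_cyc3 (i := 0) (j := 3) (l := 4) cyc isT isT isT).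
move: (cyc_preserving_cyc3 (i := 0) (j := 4) (l := 5) cyc isT isT isT).
have an := ltn_ord a; have pn i := ltn_ord (phi (v i)).
move: (pn 0) (pn 1) (pn 2) (pn 3) (pn 4) (pn 5) => p0 p1 p2 p3 p4 p5.
have [ae be] : a \in [set a; b; x] /\ b \in [set a; b; x] by rewrite !inE !eqxx !orbT.
case: phiAB => [[E _]|[_ E]]; move: ae be; rewrite -E imset3 !inE -!val_eqE /= /cyc3.
all: by do ?case: ifP; lia.
Qed.

(** * Separated triples and cyclic distance, for [M1] *)

(** A cyclic arc is a linear interval or the complement of one; [o] tells which of the two sets lies
    inside [[l, h)]. *)
Definition separated n (e f : {set 'I_n}) : Prop :=
  exists (l h : nat) o, (forall z, z \in e -> (l <= z < h) = o) /\
                        (forall z, z \in f -> (l <= z < h) = ~~ o).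

Lemma separatedC n (e f : {set 'I_n}) : separated e f -> separated f e.
Proof. by case=> l [h [o [eo fo]]]; exists l, h, (~~ o); rewrite negbK. Qed.

Lemma M1_separated n (phi : 'I_6 -> 'I_n) : cyc_preserving phi ->
  separated (phi @: [set v 0; v 1; v 2]) (phi @: [set v 3; v 4; v 5]).
Proof.
move=> cyc; rewrite !imset3.
move: (cyc_preserving_cyc3 (i := 0) (j := 1) (l := 2) cyc isT isT isT).
move: (cyc_preserving_cyc3 (i := 0) (j := 2) (l := 3) cyc isT isT isT).
move: (cyc_preserving_cyc3 (i := 0) (j := 3) (l := 4) cyc isT isT isT).
move: (cyc_preserving_cyc3 (i := 0) (j := 4) (l := 5) cyc isT isT isT).
rewrite /cyc3 => h4 h3 h2 h1.
(* At most one of the two arcs wraps around; the other serves as the interval. *)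
have [p02|p20] := ltnP (phi (v 0)) (phi (v 2)).
  exists (phi (v 0)), (phi (v 2)).+1, true.
  by split=> z; rewrite !inE -!val_eqE /=; lia.
exists (phi (v 3)), (phi (v 5)).+1, false.
by split=> z; rewrite !inE -!val_eqE /=; lia.
Qed.

Lemma separated_M1 n (H : {set {set 'I_n}}) e f : e \in H -> f \in H ->
  #|e| = 3 -> #|f| = 3 -> separated e f -> contains_copy H M1.
Proof.
have main e' f' l h : e' \in H -> f' \in H -> #|e'| = 3 -> #|f'| = 3 ->
    (forall z : 'I_n, z \in e' -> (l <= z < h) = true) ->
    (forall z : 'I_n, z \in f' -> (l <= z < h) = false) -> contains_copy H M1.
  move=> eH fH /tri_ex[a [b [c [ab bc cn eE]]]] /tri_ex[x [y [z [xy yz zn fE]]]].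
  rewrite {e'}eE {f'}fE in eH fH * => eI fO.
  have bn := ltn_trans bc cn; have an := ltn_trans ab bn.
  have yn := ltn_trans yz zn; have xn := ltn_trans xy yn.
  have := eI (Ordinal an); have := eI (Ordinal cn).
  have := fO (Ordinal xn); have := fO (Ordinal yn); have := fO (Ordinal zn).
  rewrite !inE /= !eqxx ?orbT => /(_ isT) zO /(_ isT) yO /(_ isT) xO /(_ isT) cI /(_ isT) aI.
  have fH1 : tri n y z x \in H by rewrite -tri_rot.
  have fH2 : tri n z x y \in H by rewrite tri_rot.
  (* The number of vertices of [f'] before [a] decides which rotation of [x, y, z] follows [c]. *)
  clear eI fO; have [za|az] := ltnP z a.
    by apply: (@copy_intro _ _ _ [:: a; b; c; x; y; z]) => //; rewrite /= ?/cyc3; lia.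
  have [ya|ay] := ltnP y a.
    by apply: (@copy_intro _ _ _ [:: a; b; c; z; x; y]) => //; rewrite /= ?/cyc3; lia.
  have [xa|ax] := ltnP x a.
    by apply: (@copy_intro _ _ _ [:: a; b; c; y; z; x]) => //; rewrite /= ?/cyc3; lia.
  by apply: (@copy_intro _ _ _ [:: a; b; c; x; y; z]) => //; rewrite /= ?/cyc3; lia.
move=> eH fH e3 f3 [l [h [[] [eo fo]]]]; first exact: (main e f l h).
exact: (main f e l h).
Qed.

Definition cdist (n a x : nat) : nat := if a <= x then x - a else x + n - a.

Lemma cdist_gt0 n a x : a < n -> x != a -> 0 < cdist n a x.
Proof. by rewrite /cdist; case: ifP; lia. Qed.

Lemma cdist_inj n a x y : x < n -> y < n -> a < n -> cdist n a x = cdist n a y -> x = y.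
Proof. by rewrite /cdist; do ?case: ifP; lia. Qed.

(** An arc avoiding [a] and [b] lies entirely in one of the two arcs that they cut out. *)
Lemma cdist_same_side n a b y z l h o : a < n -> b < n -> y < n -> z < n ->
  (l <= a < h) = o -> (l <= b < h) = o -> (l <= y < h) = ~~ o -> (l <= z < h) = ~~ o ->
  cdist n a y < cdist n a b -> cdist n a z < cdist n a b.
Proof. by rewrite /cdist; case: o; do ?case: ifP; lia. Qed.

Lemma cdist_separated n (a b : 'I_n) (e f : {set 'I_n}) :
  (forall z, z \in e -> cdist n a z <= cdist n a b) ->
  (forall z, z \in f -> cdist n a b < cdist n a z) -> separated e f.
Proof.
move=> eb fb; have [an bn] := (ltn_ord a, ltn_ord b).
have [ab|ba] := leqP a b.
  exists a, b.+1, true; split => z => [/eb|/fb]; have := ltn_ord z;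
    clear eb fb; rewrite /cdist; do ?case: ifP; lia.
exists b.+1, a, false; split => z => [/eb|/fb]; have := ltn_ord z;
  clear eb fb; rewrite /cdist; do ?case: ifP; lia.
Qed.

(* For each [a], let [b] be the end of the shortest cyclic interval [[a, b]] containing
   an edge [f]: an edge separated from [{a, b, x}] would lie either inside [[a, b[],
   contradicting minimality, or inside []b, a[], separated from [f]. *)
Lemma sat_M1_ge n : 2 < n -> n * (n - 2) <= 3 * sat_cyc M1 n.
Proof.
move=> n2; apply: sat_cyc_ge => [|H satH]; first by apply/set0Pn; eexists; exact: set21.
have /and3P[H3 HF _] := satH; apply: link_lower => // a; have {}H3 := forall_inP H3.
have neqAB : [set (v 0 : 'I_6); v 1; v 2] != [set v 3; v 4; v 5] by pattern_neq 0.
have [f0 f0H] : exists f0, f0 \in H.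
  have [?|eH] := boolP (tri n 0 1 2 \in H); first by exists (tri n 0 1 2).
  by have [f] := saturated_conflict neqAB satH (@card_tri n 0 1 2 isT isT n2) eH; exists f.
pose d (x : 'I_n) := cdist n a x.
pose reach (f : {set 'I_n}) := \max_(x in f) d x.
case: (arg_minnP reach f0H) => f fH fmin.
have f_gt0 g : g \in H -> 0 < #|g| by move/H3/eqP->.
have [b bf bE] := eq_bigmax_cond d (f_gt0 f fH).
have fb z : z \in f -> d z <= d b.
  by move=> zf; rewrite -bE; exact: (@leq_bigmax_cond _ (mem f) d).
have ba : b != a.
  apply/eqP => ba; have : f \subset [set a].
    apply/subsetP => z zf; have := fb z zf; rewrite inE ba /d {2}/cdist leqnn subnn.
    by apply: contraLR => za; rewrite -ltnNge cdist_gt0.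
  by move/subset_leq_card; rewrite cards1 (eqP (H3 f fH)).
exists b => // x xa xb; apply/negPn/negP => eH.
have e3 : #|[set a; b; x]| = 3.
  by rewrite -setUA cardsU1 !inE negb_or eq_sym ba eq_sym xa cards2 eq_sym xb.
have [g gH [l [h [o [eo go]]]]] : exists2 g, g \in H & separated [set a; b; x] g.
  have [g gH [phi [/M1_separated]]] := saturated_conflict neqAB satH e3 eH.
  move=> sep phiAB; exists g => //.
  by case: phiAB sep => [[-> ->]|[-> ->]] // /separatedC.
have [ao bo] : (l <= a < h) = o /\ (l <= b < h) = o.
  by split; apply: eo; rewrite !inE eqxx ?orbT.
have same_side y z : y \in g -> z \in g -> d y < d b -> d z < d b.
  by move=> /go yo /go zo; apply: (cdist_same_side _ _ _ _ ao bo yo zo).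
have [y yg yE] := eq_bigmax_cond d (f_gt0 g gH).
(* A vertex of [g] before [b] would force all of [g] before [b], against the choice of [f]. *)
have gb z : z \in g -> d b < d z.
  move=> zg; rewrite ltnNge leq_eqVlt; apply/norP; split; last first.
    apply/negP => /(same_side z y zg yg); have := fmin g gH.
    by rewrite /reach bE yE leqNgt => /negP.
  apply/eqP => /cdist_inj zb; have := go z zg; rewrite zb // bo.
  by case: (o).
case/negP: HF; apply: (separated_M1 fH gH); rewrite ?(eqP (H3 _ _)) //.
by apply: cdist_separated fb gb.
Qed.

(** * Asymptotics *)

Lemma bigO_nat (f g : nat -> nat) C N : (forall n, N <= n -> f n <= C * g n) ->
  bigO (fun n => INR (f n)) (fun n => INR (g n)).
Proof.
move=> fg; exists (INR C.+1); split; first by apply: lt_0_INR; lia.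
exists N => n /fg fgn; rewrite -mult_INR; apply: le_INR; lia.
Qed.

Lemma bigOmega_nat (f g : nat -> nat) C N : (forall n, N <= n -> g n <= C * f n) ->
  bigOmega (fun n => INR (f n)) (fun n => INR (g n)).
Proof.
move=> gf; have C0 : Rlt 0 (INR C.+1) by apply: lt_0_INR; lia.
exists (Rinv (INR C.+1)); split; first exact: Rinv_0_lt_compat.
exists N => n /gf gfn; apply: (Rmult_le_reg_l (INR C.+1)) => //.
rewrite -Rmult_assoc Rinv_r; last exact: Rgt_not_eq.
by rewrite Rmult_1_l -mult_INR; apply: le_INR; lia.
Qed.

Lemma Theta_lin k (F : {set {set 'I_k}}) C1 C2 N :
  (forall n, N <= n -> sat_cyc F n <= n * C1) ->
  (forall n, N <= n -> n - 2 <= C2 * sat_cyc F n) -> bigTheta (satR F) lin.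
Proof.
move=> up lo; split; first by apply: (@bigO_nat _ id C1 N) => n /up; rewrite mulnC.
(* For [n >= 4] one has [n <= 2 * (n - 2)]. *)
by apply: (@bigOmega_nat _ id (2 * C2) (N + 4)) => n nN; have := lo n; nia.
Qed.

Lemma Theta_quad k (F : {set {set 'I_k}}) C1 C2 N :
  (forall n, N <= n -> sat_cyc F n <= C1 * (n * n)) ->
  (forall n, N <= n -> n * n <= C2 * sat_cyc F n) -> bigTheta (satR F) quad.
Proof.
have quadE n : quad n = INR (n * n) by rewrite mult_INR.
move=> up lo; split.
  have [C [C0 [M H]]] := bigO_nat up.
  by exists C; split => //; exists M => n /H; rewrite quadE.
have [C [C0 [M H]]] := bigOmega_nat lo.
by exists C; split => //; exists M => n /H; rewrite quadE.
Qed.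

Lemma quad_of_pairs n s C : 4 <= n -> n * (n - 2) <= C * s -> n * n <= (2 * C) * s.
Proof. nia. Qed.

(** The hypothesis gives [(n-1)(n-2) <= 18 s], and [n * n] is at most [8/3] times the left side for
    [n >= 4]; [48 = 18 * 8/3]. *)
Lemma quad_of_triples n s : 4 <= n -> 'C(n, 3) <= 3 * n * s -> n * n <= 48 * s.
Proof.
move=> n4; have := bin_ffact n 3; rewrite !ffactnS ffactn0 /= muln1 (_ : 3`! = 6) // => E Cs.
have : n * (n.-1 * n.-2) <= n * (18 * s) by lia.
by rewrite leq_pmul2l; [nia | lia].
Qed.

Lemma bigO_nlog2n f : bigO f lin -> bigO f nlog2n.
Proof.
move=> [C [C0 [N fN]]]; exists C; split => //; exists (N + 2) => n nN.
apply: (Rle_trans _ _ _ (fN n _)); first by lia.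
apply: Rmult_le_compat_l; first exact: Rlt_le.
rewrite /lin /nlog2n -{1}[INR n]Rmult_1_r; apply: Rmult_le_compat_l; first exact: pos_INR.
have ln2 : Rlt 0 (ln 2) by rewrite -ln_1; apply: ln_increasing; lra.
apply: (Rmult_le_reg_r (ln 2)) => //; rewrite Rmult_1_l /Rdiv Rmult_assoc Rinv_l; last first.
  exact: Rgt_not_eq.
rewrite Rmult_1_r; have /Rle_lt_or_eq_dec[lt2|<-] : Rle 2 (INR n); last exact: Rle_refl.
  by apply: (Rle_trans _ (INR 2)); [rewrite /=; lra | apply: le_INR; lia].
by apply/Rlt_le/ln_increasing => //; lra.
Qed.

Theorem theorem1p2 :
  (bigTheta (satR M2) lin /\ bigTheta (satR S1) lin /\ bigTheta (satR S2) lin) /\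
  (bigTheta (satR M1) quad /\ bigTheta (satR M3) quad /\
   bigTheta (satR D1) quad /\ bigTheta (satR D2) quad) /\
  (bigOmega (satR S3) lin /\ bigO (satR S3) nlog2n).
Proof.
(* The linear upper bound is stronger than the required [n log n]. *)
have S3_lin : bigTheta (satR S3) lin.
  by apply: (@Theta_lin _ _ 3 3 0) => n _; [have := sat_S3_le n; lia | exact: sat_S3_ge].
split; [split; [|split] | split; [split; [|split; [|split]] | split]].
- by apply: (@Theta_lin _ _ 324 1 0) => n _; [have := sat_M2_le n; lia | exact: sat_M2_ge].
- by apply: (@Theta_lin _ _ 28 3 0) => n _; [have := sat_S1_le n; lia | exact: sat_S1_ge].
- by apply: (@Theta_lin _ _ 3 3 0) => n _; [have := sat_S2_le n; lia | exact: sat_S2_ge].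
- apply: (@Theta_quad _ _ 3 6 4) => n n4; first by have := sat_M1_le n; lia.
  by apply: (@quad_of_pairs _ _ 3) => //; apply: sat_M1_ge; lia.
- apply: (@Theta_quad _ _ 3 6 4) => n n4; first by have := sat_M3_le n; lia.
  by apply: (@quad_of_pairs _ _ 3) => //; apply: sat_M3_ge; lia.
- apply: (@Theta_quad _ _ 1 48 4) => n n4; first by have := sat_D1_le n; lia.
  exact: quad_of_triples (sat_D1_ge n).
- apply: (@Theta_quad _ _ 1 48 4) => n n4; first by have := sat_D2_le n; lia.
  exact: quad_of_triples (sat_D2_ge n).
- exact: S3_lin.2.
exact: bigO_nlog2n S3_lin.1.
Qed.
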